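(* Let $A=I-W\in\mathbb{R}^{N\times N}$ be a frozen transport matrix with directed dependency graph $\mathcal{G}(A)$. Let $C_1,\dots,C_m$ be the strongly connected components of $\mathcal{G}(A)$ listed in a topological order of the condensation graph, let $\Pi$ be a corresponding permutation matrix, and let $\widehat A=\Pi A\Pi^{T}$ be the resulting block lower-triangular matrix with blocks $A_{k\ell}$, $1\le \ell\le k\le m$. If every diagonal block $A_{kk}$ is nonsingular, then for every right-hand side $\mathbf{b}\in\mathbb{R}^{N}$, with $\Pi\mathbf{b}$ partitioned into blocks $\mathbf{b}_1,\dots,\mathbf{b}_m$ conformally, the topological block traversal $$A_{kk}\mathbf{x}_k=\mathbf{b}_k-\sum_{\ell<k}A_{k\ell}\mathbf{x}_\ell,\qquad k=1,\dots,m,$$ solves the full system exactly (in exact arithmetic): it determines blocks $\mathbf{x}_1,\dots,\mathbf{x}_m$, and the vector $\mathbf{x}=\Pi^{T}(\mathbf{x}_1;\dots;\mathbf{x}_m)$ satisfies $A\mathbf{x}=\mathbf{b}$.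
   Context: The frozen transport matrix is $A=I-W$, where $W=(w_{ij})\in\mathbb{R}^{N\times N}$ is entrywise nonnegative with zero diagonal. The directed dependency graph $\mathcal{G}(A)$ has vertex set $\{1,\dots,N\}$ and an edge $j\to i$ if and only if $w_{ij}>0$. The strongly connected components (SCCs) are the maximal vertex subsets in which every pair of vertices is mutually reachable. The condensation graph is obtained by collapsing each SCC to one supernode; it is a directed acyclic graph. A topological order $C_1,\dots,C_m$ of the SCCs means that any edge $j\to i$ with $j\in C_\ell$, $i\in C_k$ has $\ell\le k$. The permutation $\Pi$ reorders the unknowns so that those of $C_1$ come first, then those of $C_2$, and so on; $A_{k\ell}$ denotes the submatrix of $A$ with rows in $C_k$ and columns in $C_\ell$ (in the chosen ordering), so that $A_{k\ell}=0$ for $\ell>k$. *)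

(* Defs.v *)
From mathcomp Require Import all_boot all_order all_fingroup all_algebra.
From mathcomp Require Import reals.

Set Implicit Arguments.
Unset Strict Implicit.
Unset Printing Implicit Defensive.

Import Order.TTheory GRing.Theory Num.Theory.
Local Open Scope ring_scope.

Definition transport_weights (R : realType) (N : nat) (W : 'M[R]_N) : Prop :=
  (forall i j, 0 <= W i j) /\ (forall i, W i i = 0).

Definition transport_matrix (R : realType) (N : nat) (W : 'M[R]_N) : 'M[R]_N :=
  1%:M - W.

(* [dep_edge W j i] is the edge j -> i: the source is the column index of W. *)
Definition dep_edge (R : realType) (N : nat) (W : 'M[R]_N) : rel 'I_N :=
  fun j i => 0 < W i j.

Definition mutually_reachable (T : finType) (e : rel T) (S : {set T}) : bool :=
  [forall x in S, forall y in S, connect e x y && connect e y x].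

(* The empty set is a maximal mutually reachable set only when T is empty;
   it is not counted as a component. *)
Definition is_scc (T : finType) (e : rel T) (S : {set T}) : bool :=
  (S != set0) && maxset (mutually_reachable e) S.

Record scc_topological_order (T : finType) (e : rel T) (m : nat)
    (C : 'I_m -> {set T}) : Prop := SccTopologicalOrder {
  topo_scc : forall k, is_scc e (C k);
  topo_inj : injective C;
  topo_all : forall S, is_scc e S -> exists k, C k = S;
  topo_edge : forall k l i j, j \in C l -> i \in C k -> e j i -> (l <= k)%N
}.

(* Since (perm_mx s *m v) p = v (s p), position p of the reordered vector holds
   the unknown s p. *)
Definition groups_components (N m : nat) (C : 'I_m -> {set 'I_N}) (s : 'S_N) :
    Prop :=
  forall p q k l, s p \in C k -> s q \in C l -> (k < l)%N -> (p < q)%N.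

Lemma scc_sizes (N m : nat) (e : rel 'I_N) (C : 'I_m -> {set 'I_N}) :
  scc_topological_order e C -> N = (\sum_(k < m) #|C k|)%N.
Proof.
case=> Cscc Cinj Call _.
have mrP S x y : mutually_reachable e S -> x \in S -> y \in S -> connect e x y.
  by move=> /forall_inP/(_ x) h xS yS; have /forall_inP/(_ y yS)/andP[] := h xS.
have Cuniq i k l : i \in C k -> i \in C l -> k = l.
  move=> ik il; apply: Cinj.
  have /andP[_ /maxsetP[rk maxk]] := Cscc k.
  have /andP[_ /maxsetP[rl maxl]] := Cscc l.
  have rU : mutually_reachable e (C k :|: C l).
    have to_i x : x \in C k :|: C l -> connect e x i && connect e i x.
      by case/setUP=> xC; apply/andP; split;
        first [exact: (mrP (C k)) | exact: (mrP (C l))].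
    apply/forall_inP=> x /to_i/andP[xi ix].
    apply/forall_inP=> y /to_i/andP[yi iy].
    by rewrite (connect_trans xi iy) (connect_trans yi ix).
  by rewrite -(maxk _ rU (subsetUl _ _)) (maxl _ rU (subsetUr _ _)).
have Ccov i : exists k, i \in C k.
  have ri : mutually_reachable e [set i].
    apply/forall_inP=> x /set1P ->; apply/forall_inP=> y /set1P ->.
    by rewrite connect0.
  have [S maxS] := maxset_exists ri; rewrite sub1set => iS.
  have /Call[k Ck] : is_scc e S by rewrite /is_scc maxS andbT; apply/set0Pn; exists i.
  by exists k; rewrite Ck.
transitivity (\sum_(i < N) 1)%N; first by rewrite sum1_card card_ord.
transitivity (\sum_(i < N) \sum_(k < m) (i \in C k : nat))%N.
  apply: eq_bigr => i _; have [k ik] := Ccov i.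
  rewrite (bigD1 k) //= ik big1 // => l lk.
  by apply/eqP; rewrite eqb0; apply: contra lk => il; rewrite (Cuniq i l k).
rewrite exchange_big; apply: eq_bigr => k _.
by rewrite -sum1_card [RHS]big_mkcond; apply: eq_bigr => i _; case: (i \in C k).
Qed.

Section Blocks.

Variables (R : realType) (N m : nat) (C : 'I_m -> {set 'I_N}).
Hypothesis eN : N = (\sum_(k < m) #|C k|)%N.

(* Blocks with respect to the sizes #|C 0|, #|C 1|, ... of the consecutive
   groups of indices; the cast only makes the type show the block structure. *)
Definition mx_block (B : 'M[R]_N) (k l : 'I_m) : 'M[R]_(#|C k|, #|C l|) :=
  submxblock (castmx (eN, eN) B) k l.

Definition vec_block (v : 'cV[R]_N) (k : 'I_m) : 'cV[R]_#|C k| :=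
  submxcol (castmx (eN, erefl 1%N) v) k.

Definition vec_stack (x : forall k, 'cV[R]_#|C k|) : 'cV[R]_N :=
  castmx (esym eN, erefl 1%N) (\mxcol_k x k).

Definition block_traversal (B : 'M[R]_N) (v : 'cV[R]_N)
    (x : forall k, 'cV[R]_#|C k|) : Prop :=
  forall k, mx_block B k k *m x k =
            vec_block v k - \sum_(l < m | (l < k)%N) mx_block B k l *m x l.

End Blocks.

(* Main.v *)
Require Import Defs.
From mathcomp Require Import all_boot all_order all_fingroup all_algebra.
From mathcomp Require Import reals.

(** A block lower-triangular system [M *m x = v] is the same thing as its
    forward substitution: row [k] of the
    system reads [M_kk x_k + sum_(l < k) M_kl x_l = v_k], because the blocks to
    the right of the diagonal vanish ([forward_substitutionP]). Strong induction
    on [k] shows that, with invertible [M_kk], forward substitution has at most one solution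
    ([forward_substitution_inj]); applied to [v = 0] this makes [M] injective,
    hence invertible ([block_lower_unitmx]), so that the solution exists and is
    the vector of blocks of [M^-1 v].

    What remains is that the reordered transport matrix is block lower
    triangular. An entry of block [(k, l)] is an entry of [A] with row in [C k]
    and column in [C l]; if [k < l] it lies off the diagonal and, were it
    nonzero, the nonnegative weight would be positive and give an edge from
    [C l] to the earlier component [C k].

    This uses that the positions of the [k]-th consecutive block are exactly
    those whose unknown lies in [C k], whereas the hypothesis on the permutation
    only says that it respects the order of the components. The two agree by
    counting: the component index and the block index are both nondecreasing
    functions of the position with fibres of sizes [#|C k|], and a nondecreasing
    function on an initial segment of the naturals is determined by the sizes of
    its fibres ([homo_fibers_eq]). *)

Set Implicit Arguments.
Unset Strict Implicit.
Unset Printing Implicit Defensive.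

Import Order.TTheory GRing.Theory Num.Theory.
Local Open Scope ring_scope.

(** * Nondecreasing functions and their fibres *)

(** A nondecreasing [f] has initial segments as sublevel sets, and an initial
    segment is determined by its cardinality. *)
Lemma homo_ltn_card (n m : nat) (f : 'I_n -> 'I_m) (k : nat) (p : 'I_n) :
    {homo f : p q / (p <= q)%N} ->
  (f p < k)%N = (p < #|[set q | f q < k]|)%N.
Proof.
move=> f_homo; apply/idP/idP => [fpk | ].
  have /subset_leq_card : [set q : 'I_n | q < p.+1]%N \subset [set q | f q < k]%N.
    by apply/subsetP=> q; rewrite !inE ltnS => /f_homo /leq_ltn_trans; apply.
  by rewrite -[X in (X <= _)%N]sum1dep_card (big_ord_narrow (ltn_ord p)) /=
             sum1_card card_ord.
apply: contraLR; rewrite -!leqNgt => kfp.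
have /subset_leq_card : [set q | f q < k]%N \subset [set q : 'I_n | q < p]%N.
  apply/subsetP=> q; rewrite !inE => fqk; rewrite ltnNge.
  by apply: contraL fqk => /f_homo; rewrite -leqNgt; apply: leq_trans.
move/leq_trans; apply.
by rewrite -sum1dep_card (big_ord_narrow (ltnW (ltn_ord p))) /= sum1_card card_ord.
Qed.

Lemma card_ltn_fibers (n m : nat) (f : 'I_n -> 'I_m) (k : nat) :
  #|[set q | f q < k]%N| = (\sum_(l < m | l < k) #|[set q | f q == l]|)%N.
Proof.
rewrite -sum1dep_card (partition_big f (fun l : 'I_m => l < k)%N) //=.
apply: eq_bigr => l lk; rewrite -sum1dep_card; apply: eq_bigl => q.
by case: eqP => [->|]; rewrite ?lk ?andbF.
Qed.

Lemma homo_fibers_eq (n m : nat) (f g : 'I_n -> 'I_m) :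
    {homo f : p q / (p <= q)%N} -> {homo g : p q / (p <= q)%N} ->
    (forall l, #|[set q | f q == l]| = #|[set q | g q == l]|) ->
  f =1 g.
Proof.
move=> f_homo g_homo fibers p.
have lt_fg k : (f p < k)%N = (g p < k)%N.
  rewrite !homo_ltn_card // !card_ltn_fibers.
  by under eq_bigr do rewrite fibers.
by apply/val_inj/eqP; rewrite eqn_leq -ltnS lt_fg ltnSn -ltnS -lt_fg ltnSn.
Qed.

Lemma card_sig1_fiber (m : nat) (q_ : 'I_m -> nat) (k : 'I_m) :
  #|[set p | tagnat.sig1 (p_ := q_) p == k]| = q_ k.
Proof.
have -> : [set p | tagnat.sig1 (p_ := q_) p == k]
          = [set tagnat.Rank (p_ := q_) k j | j in [set: 'I_(q_ k)]].
  apply/setP=> p; rewrite inE; apply/eqP/imsetP=> [<- | [j _ ->]].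
    by exists (tagnat.sig2 p); rewrite ?tagnat.sig2K.
  exact: tagnat.Rank1K.
rewrite card_imset ?cardsT ?card_ord // => i j /(congr1 val)/eqP.
by rewrite tagnat.eq_Rank eqxx => /eqP/val_inj.
Qed.

(** * Block forward substitution *)

Section ForwardSubstitution.

Variables (F : fieldType) (m : nat) (q_ : 'I_m -> nat).
Implicit Types (M : 'M[F]_(\sum_k q_ k)) (v : 'cV[F]_(\sum_k q_ k)).
Implicit Types (x y : forall k, 'cV[F]_(q_ k)).

Definition block_lower M :=
  forall k l : 'I_m, (k < l)%N -> submxblock M k l = 0.

Definition forward_substitution M v x :=
  forall k, submxblock M k k *m x k =
            submxcol v k - \sum_(l < m | (l < k)%N) submxblock M k l *m x l.

(** Lower triangularity removes the terms [l > k] from row [k] of the product;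
    moving the terms [l < k] to the right-hand side gives step [k]. *)
Lemma forward_substitutionP M v x : block_lower M ->
  forward_substitution M v x <-> M *m \mxcol_k x k = v.
Proof.
move=> Mlow.
have row_k k : submxcol (M *m \mxcol_k x k) k = submxblock M k k *m x k +
                 \sum_(l < m | (l < k)%N) submxblock M k l *m x l.
  rewrite -{1}[M]submxblockK mul_mxblock_mxrow mxcolK (bigD1 k) //=.
  congr (_ + _); rewrite [RHS]big_mkcond [LHS]big_mkcond; apply: eq_bigr => l _.
  by rewrite neq_ltn; case: ltngtP => //= kl; rewrite Mlow // mul0mx.
split=> [fs | <- k]; last by rewrite row_k addrK.
by apply/mxcolP=> k; rewrite row_k fs subrK.
Qed.

(** Step [k] determines block [k] from the previous ones, since [M_kk] is
    invertible. *)
Lemma forward_substitution_inj M v x y :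
    (forall k, submxblock M k k \in unitmx) ->
    forward_substitution M v x -> forward_substitution M v y ->
  forall k, x k = y k.
Proof.
move=> Mdiag fx fy k.
have [n] := ubnP (k : nat); elim: n k => // n IHn k kn.
apply: (can_inj (mulKmx (Mdiag k))); rewrite fx fy; congr (_ - _).
by apply: eq_bigr => l lk; rewrite IHn // (leq_trans lk).
Qed.

(** A kernel vector of [M] is produced by forward substitution from the zero
    right-hand side, just as the zero vector is, so it vanishes. *)
Lemma block_lower_unitmx M :
    block_lower M -> (forall k, submxblock M k k \in unitmx) -> M \in unitmx.
Proof.
move=> Mlow Mdiag.
(* Injectivity on columns is freeness of the rows of the transpose. *)
rewrite -unitmx_tr -row_free_unit.
apply: inj_row_free => u uM0.
have fs_u : forward_substitution M 0 (submxcol u^T).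
  apply/forward_substitutionP => //; rewrite submxcolK.
  by rewrite -[M]trmxK -trmx_mul uM0 trmx0.
have fs_0 : forward_substitution M 0 (submxcol 0).
  by apply/forward_substitutionP => //; rewrite submxcolK mulmx0.
apply: trmx_inj; rewrite trmx0; apply/mxcolP.
exact: forward_substitution_inj Mdiag fs_u fs_0.
Qed.

End ForwardSubstitution.

Lemma castmx_mulmx_col (F : pzSemiRingType) (n n' : nat) (e : n = n')
    (B : 'M[F]_n) (v : 'cV[F]_n) :
  castmx (e, e) B *m castmx (e, erefl 1%N) v = castmx (e, erefl 1%N) (B *m v).
Proof. by case: n' / e; rewrite !castmx_id. Qed.

(** * The reordered transport matrix *)

Lemma scc_cover (T : finType) (e : rel T) (m : nat) (C : 'I_m -> {set T}) :
  scc_topological_order e C -> forall i, exists k, i \in C k.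
Proof.
case=> _ _ Call _ i.
(* The component of [i] is a maximal mutually reachable set around [i]. *)
have ri : mutually_reachable e [set i].
  apply/forall_inP=> x /set1P ->; apply/forall_inP=> y /set1P ->.
  by rewrite connect0.
have [S maxS] := maxset_exists ri; rewrite sub1set => iS.
have /Call[k Ck] : is_scc e S by rewrite /is_scc maxS andbT; apply/set0Pn; exists i.
by exists k; rewrite Ck.
Qed.

(** The order condition on [s] also separates the components: a position in both
    [C k] and [C l] with [k < l] would have to precede itself. *)
Lemma groups_components_inj (N m : nat) (C : 'I_m -> {set 'I_N}) (s : 'S_N) :
    groups_components C s ->
  forall p k l, s p \in C k -> s p \in C l -> k = l.
Proof.
move=> hs p k l pk pl; apply: val_inj; case: (ltngtP k l) => // kl.
- by have := hs p p k l pk pl kl; rewrite ltnn.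
- by have := hs p p l k pl pk kl; rewrite ltnn.
Qed.

(** Sending a position to the component of its unknown is nondecreasing because
    [s] respects the order of the components, and has fibres of sizes [#|C k|]
    because [s] is a bijection; so it is the block index [tagnat.sig1]. *)
Lemma groups_components_Rank (N m : nat) (C : 'I_m -> {set 'I_N}) (s : 'S_N)
    (eN : N = (\sum_(k < m) #|C k|)%N) :
    groups_components C s -> (forall i, exists k, i \in C k) ->
  forall k (j : 'I_#|C k|),
    s (cast_ord (esym eN) (tagnat.Rank (p_ := fun l => #|C l|) k j)) \in C k.
Proof.
move=> hs cover k j.
have /fin_all_exists[f fC] p : exists l, s (cast_ord (esym eN) p) \in C l.
  exact: cover.
have f_eq p l : (f p == l) = (s (cast_ord (esym eN) p) \in C l).
  apply/eqP/idP=> [<- // | pl].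
  exact: (groups_components_inj hs (fC p) pl).
have f_sig1 : f =1 tagnat.sig1.
  apply: homo_fibers_eq => [p q pq | p q | l].
  - rewrite leqNgt; apply: contraL pq => fqp; rewrite -ltnNge.
    exact: (hs _ _ _ _ (fC q) (fC p) fqp).
  - exact: tagnat.le_sig1.
  have -> : [set q | f q == l] = (s \o cast_ord (esym eN)) @^-1: C l.
    by apply/setP=> q; rewrite !inE f_eq.
  rewrite card_sig1_fiber on_card_preimset //; apply: onW_bij.
  apply: bij_comp; first by exists (s^-1)%g; [exact: permK | exact: permKV].
  by exists (cast_ord eN) => q; rewrite ?cast_ordK ?cast_ordKV.
by have := fC (tagnat.Rank k j); rewrite f_sig1 tagnat.Rank1K.
Qed.

Lemma transport_matrix_block_lower (R : realType) (N : nat) (W : 'M[R]_N)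
    (m : nat) (C : 'I_m -> {set 'I_N})
    (eN : N = (\sum_(k < m) #|C k|)%N) (s : 'S_N) :
    transport_weights W -> scc_topological_order (dep_edge W) C ->
    groups_components C s ->
  block_lower (castmx (eN, eN)
    (perm_mx s *m transport_matrix W *m (perm_mx s)^T)).
Proof.
move=> [W_ge0 _] hC hs k l kl; apply/matrixP=> i j.
rewrite tr_perm_mx -col_permE -row_permE /submxblock !mxE castmxE !mxE /=.
set p := s _; set q := s _.
have pk : p \in C k := groups_components_Rank eN hs (scc_cover hC) i.
have ql : q \in C l := groups_components_Rank eN hs (scc_cover hC) j.
have -> : (p == q) = false.
  apply/eqP=> pq; move: ql; rewrite -pq => pl.
  by move: (kl); rewrite (groups_components_inj hs pk pl) ltnn.
have [Wpq | Wpq] := ltP 0 (W p q).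
  by have := topo_edge hC ql pk Wpq; rewrite leqNgt kl.
have -> : W p q = 0 by apply/le_anti; rewrite Wpq W_ge0.
by rewrite subr0.
Qed.

Theorem proposition4p1 (R : realType) (N : nat) (W : 'M[R]_N)
    (hW : transport_weights W)
    (m : nat) (C : 'I_m -> {set 'I_N})
    (hC : scc_topological_order (dep_edge W) C)
    (s : 'S_N) (hs : groups_components C s) :
  let A := transport_matrix W in
  let P : 'M[R]_N := perm_mx s in
  let Ahat := P *m A *m P^T in
  let eN := scc_sizes hC in
  (forall k l : 'I_m, (k < l)%N -> mx_block eN Ahat k l = 0) /\
  ((forall k, mx_block eN Ahat k k \in unitmx) ->
   forall b : 'cV[R]_N,
   exists x : forall k : 'I_m, 'cV[R]_#|C k|,
     [/\ block_traversal eN Ahat (P *m b) x,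
         forall y, block_traversal eN Ahat (P *m b) y -> forall k, y k = x k
       & A *m (P^T *m vec_stack eN x) = b]).
Proof.
move=> A P Ahat eN.
have low : block_lower (castmx (eN, eN) Ahat).
  exact: transport_matrix_block_lower.
split=> // diag b.
have unitM := block_lower_unitmx low diag.
pose M := castmx (eN, eN) Ahat; pose v := castmx (eN, erefl 1%N) (P *m b).
pose x := submxcol (invmx M *m v).
have Mx : M *m \mxcol_k x k = v by rewrite submxcolK mulKVmx.
have fs_x : forward_substitution M v x by apply/forward_substitutionP.
exists x; split=> // [y fs_y |]; first exact: forward_substitution_inj fs_y fs_x.
have AhatPb : Ahat *m vec_stack eN x = P *m b.
  apply: (can_inj (castmxK eN (erefl 1%N))).
  by rewrite -castmx_mulmx_col /vec_stack castmxKV.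
apply: (can_inj (mulKmx (unitmx_perm R s))).
by rewrite -AhatPb /Ahat !mulmxA.
Qed.
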